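(* Let $\Gamma$ be a finite graph. The Zariski tangent space $T_{\underline 0}(X_\Gamma)$ of the cographic toric variety $X_\Gamma$ at its torus fixed point $\underline 0$ has dimension $$\dim T_{\underline 0}(X_\Gamma)=2|\operatorname{Cir}(\Gamma)|+|E(\Gamma)|-|\operatorname{Loops}(\Gamma)|.$$
   Context: A graph $\Gamma$ consists of a set $V(\Gamma)$ of vertices, a set $\vec E(\Gamma)$ of oriented edges, a fixed-point-free involution $\iota$ of $\vec E(\Gamma)$, and maps $s,t:\vec E(\Gamma)\to V(\Gamma)$ with $s(\vec e)=t(\iota(\vec e))$ (loops and parallel edges are allowed). $E(\Gamma)=\vec E(\Gamma)/\iota$ is the set of unoriented edges. A circuit is a connected graph without separating edges and with $b_1=|E|-|V|+1=1$ (a cycle); a loop is a circuit with a single edge. $\operatorname{Cir}(\Gamma)$ is the set of (unoriented) circuits contained in $\Gamma$ as subgraphs, and $\operatorname{Loops}(\Gamma)$ is the set of loops of $\Gamma$. The oriented homology $\mathbb H_1(\Gamma,\mathbb Z)$ is the kernel of the map $\mathbb Z^{\vec E(\Gamma)}\to\mathbb Z^{V(\Gamma)}$, $\vec e\mapsto t(\vec e)-s(\vec e)$. $C(\Gamma)\subset\mathbb H_1(\Gamma,\mathbb Z)$ is the semigroup of elements with all coefficients $\ge0$ in the basis $\vec E(\Gamma)$, and $U(\Gamma)=k[C(\Gamma)]$ is its semigroup algebra over the base field $k$, with basis $\{X^c:c\in C(\Gamma)\}$. Finally $X_\Gamma=\operatorname{Spec}U(\Gamma)$, and $\underline 0\in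 X_\Gamma$ is the point corresponding to the maximal ideal spanned by the $X^c$ with $c\neq0$, which is the unique torus fixed point. *)

(* Defs.v *)
From HB Require Import structures.
From mathcomp Require Import all_boot all_order all_algebra ring.
From mathcomp Require Import generic_quotient ring_quotient.
From mathcomp Require Import boolp functions.
From mathcomp Require Import finmap monalg.

Set Implicit Arguments.
Unset Strict Implicit.
Unset Printing Implicit Defensive.

Import Order.TTheory GRing.Theory Num.Theory.
Local Open Scope ring_scope.
Local Open Scope quotient_scope.

Section LinearAlgebra.
Context {R : nzRingType}.

Definition has_dim (V : lmodType R) (n : nat) : Prop :=
  inhabited (Vector.axiom n V).

Section Submodule.
Context (V : lmodType R) (W : submodClosed V).

Record submodule : Type :=
  Submodule { submodule_val :> V; _ : submodule_val \in W }.

HB.instance Definition _ := [isSub for submodule_val].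
HB.instance Definition _ := [Choice of submodule by <:].
HB.instance Definition _ := [SubChoice_isSubLmodule of submodule by <:].

End Submodule.

Section QuotientModule.
Context (V : lmodType R) (W : submodClosed V).

(* submodClosed does not inherit from zmodClosed, which Quotient.quot needs. *)
Definition quotmod_ker : {pred V} := fun x => x \in W.

HB.instance Definition _ := GRing.isZmodClosed.Build V quotmod_ker
  (GRing.subsemimod_closedB (GRing.subsemimodClosedP W)).

Definition quotmod : Type := Quotient.quot quotmod_ker.

HB.instance Definition _ := GRing.Zmodule.on quotmod.

Definition quotmod_proj (x : V) : quotmod := \pi_(Quotient.quot quotmod_ker) x.

Definition quotmod_scale (a : R) (x : quotmod) : quotmod :=
  quotmod_proj (a *: repr (x : Quotient.quot quotmod_ker)).

Lemma quotmod_projW (P : quotmod -> Prop) :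
  (forall x, P (quotmod_proj x)) -> forall x, P x.
Proof. by move=> h x; rewrite -[x](@reprK _ (Quotient.quot quotmod_ker)); apply: h. Qed.

Lemma quotmod_projE x y : (quotmod_proj x = quotmod_proj y) <-> (x - y \in W).
Proof.
by rewrite (Quotient.idealrBE quotmod_ker); split=> [/eqP|/eqP].
Qed.

Lemma quotmod_projD x y :
  quotmod_proj (x + y) = quotmod_proj x + quotmod_proj y.
Proof. exact: (raddfD (\pi_(Quotient.quot quotmod_ker))). Qed.

Lemma quotmod_projZ a x :
  quotmod_scale a (quotmod_proj x) = quotmod_proj (a *: x).
Proof.
apply/quotmod_projE; rewrite -scalerBr; apply: rpredZ.
by rewrite (Quotient.idealrBE quotmod_ker) reprK.
Qed.

Lemma quotmod_scaleA a b x :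
  quotmod_scale a (quotmod_scale b x) = quotmod_scale (a * b) x.
Proof. by elim/quotmod_projW: x => x; rewrite !quotmod_projZ scalerA. Qed.

Lemma quotmod_scale1 : left_id 1 quotmod_scale.
Proof. by elim/quotmod_projW => x; rewrite quotmod_projZ scale1r. Qed.

Lemma quotmod_scaleDr : right_distributive quotmod_scale +%R.
Proof.
move=> a; elim/quotmod_projW => x; elim/quotmod_projW => y.
by rewrite -quotmod_projD !quotmod_projZ scalerDr quotmod_projD.
Qed.

Lemma quotmod_scaleDl x : {morph quotmod_scale^~ x : a b / a + b}.
Proof.
move=> a b; elim/quotmod_projW: x => x.
by rewrite !quotmod_projZ scalerDl quotmod_projD.
Qed.

HB.instance Definition _ := GRing.Zmodule_isLmodule.Build R quotmod
  quotmod_scaleA quotmod_scale1 quotmod_scaleDr quotmod_scaleDl.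

End QuotientModule.
End LinearAlgebra.

Section Dual.
Context {k : comNzRingType} (V : lmodType k).

Definition linear_form : {pred V -> k^o} := [pred f | `[< linear f >]].

Lemma linear_form_submod_closed : submod_closed linear_form.
Proof.
split=> [|a f g]; rewrite ?inE.
  by apply/asboolP => b u v; rewrite /= scaler0 addr0.
move=> /asboolP lf /asboolP lg; apply/asboolP => b u v.
rewrite !addrfctE !scalrfctE lf lg !scalerDr !scalerA [a * b]mulrC.
by rewrite addrACA.
Qed.

HB.instance Definition _ :=
  GRing.isSubmodClosed.Build k (V -> k^o) linear_form linear_form_submod_closed.

Definition dual : lmodType k := submodule linear_form.

End Dual.

(* Points are boolean prime ideals; with classical logic this is no
   restriction. *)
Definition Spec (A : comNzRingType) : Type := prime_idealr A.

Section Localization.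
Context {k : comNzRingType} {A : comAlgType k} (p : Spec A).

Record locfrac : Type := LocFrac { locpair :> A * A; _ : locpair.2 \notin p }.

HB.instance Definition _ := [isSub for locpair].
HB.instance Definition _ := [Choice of locfrac by <:].

Implicit Types x y z : locfrac.

Lemma locdenP x : x.2 \notin p. Proof. by case: x. Qed.

Lemma locden1P : (1 : A) \notin p.
Proof. by rewrite -topredE /= [p 1]idealr1. Qed.

Lemma locdenM (s t : A) : s \notin p -> t \notin p -> s * t \notin p.
Proof.
by move=> sp tp; rewrite -topredE /= [p _]prime_idealrM negb_or sp tp.
Qed.

Definition loceq x y : bool :=
  `[< exists2 u : A, u \notin p & u * (x.1 * y.2) = u * (y.1 * x.2) >].

Lemma loceqP x y :
  reflect (exists2 u : A, u \notin p & u * (x.1 * y.2) = u * (y.1 * x.2))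
          (loceq x y).
Proof. exact: asboolP. Qed.

Lemma loceq_refl : reflexive loceq.
Proof. by move=> x; apply/loceqP; exists 1 => //; exact: locden1P. Qed.

Lemma loceq_sym : symmetric loceq.
Proof. by move=> x y; apply/loceqP/loceqP => -[u up e]; exists u. Qed.

Lemma loceq_trans : transitive loceq.
Proof.
move=> y x z /loceqP[u up xy] /loceqP[v vp yz]; apply/loceqP.
exists (u * v * y.2); first by rewrite !locdenM ?locdenP.
have -> : u * v * y.2 * (x.1 * z.2) = v * z.2 * (u * (x.1 * y.2)) by ring.
have -> : u * v * y.2 * (z.1 * x.2) = u * x.2 * (v * (z.1 * y.2)) by ring.
by rewrite xy -yz; ring.
Qed.

Canonical loceq_equiv := EquivRel loceq loceq_refl loceq_sym loceq_trans.

(* The local ring of Spec A at p *)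
Definition localring : Type := {eq_quot loceq}.

HB.instance Definition _ : EqQuotient locfrac loceq localring :=
  EqQuotient.on localring.
HB.instance Definition _ := Choice.on localring.

Definition locclass x : localring := \pi_localring x.

Lemma locclassW (P : localring -> Prop) :
  (forall x, P (locclass x)) -> forall a, P a.
Proof. by move=> h a; rewrite -[a]reprK; apply: h. Qed.

Lemma locclassP x y : locclass x = locclass y <-> loceq x y.
Proof. by split => [/eqmodP|h]; last apply/eqmodP. Qed.

Lemma loceq_repr x : loceq (repr (locclass x)) x.
Proof. by apply/locclassP; rewrite /locclass reprK. Qed.

Definition locfrac0 : locfrac := @LocFrac (0, 1) locden1P.
Definition locfrac1 : locfrac := @LocFrac (1, 1) locden1P.
Definition locfrac_opp x : locfrac := @LocFrac (- x.1, x.2) (locdenP x).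
Definition locfrac_scale (c : k) x : locfrac :=
  @LocFrac (c *: x.1, x.2) (locdenP x).
Definition locfrac_add x y : locfrac :=
  @LocFrac (x.1 * y.2 + y.1 * x.2, x.2 * y.2)
           (locdenM (locdenP x) (locdenP y)).
Definition locfrac_mul x y : locfrac :=
  @LocFrac (x.1 * y.1, x.2 * y.2) (locdenM (locdenP x) (locdenP y)).

Definition loc_opp (a : localring) := locclass (locfrac_opp (repr a)).
Definition loc_scale (c : k) (a : localring) :=
  locclass (locfrac_scale c (repr a)).
Definition loc_add (a b : localring) :=
  locclass (locfrac_add (repr a) (repr b)).
Definition loc_mul (a b : localring) :=
  locclass (locfrac_mul (repr a) (repr b)).

Lemma loc_oppE x : loc_opp (locclass x) = locclass (locfrac_opp x).
Proof.
apply/locclassP/loceqP; have /loceqP[u up e] := loceq_repr x.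
by exists u => //=; rewrite !mulNr !mulrN e.
Qed.

Lemma loc_scaleE c x : loc_scale c (locclass x) = locclass (locfrac_scale c x).
Proof.
apply/locclassP/loceqP; have /loceqP[u up e] := loceq_repr x.
by exists u => //=; rewrite -!scalerAl -!scalerAr e.
Qed.

Lemma loc_addE x y :
  loc_add (locclass x) (locclass y) = locclass (locfrac_add x y).
Proof.
apply/locclassP/loceqP.
have := loceq_repr x; have := loceq_repr y.
move: (repr (locclass x)) (repr (locclass y)) => x' y' /loceqP[v vp ey] /loceqP[u up ex].
exists (u * v) => /=; first exact: locdenM.
transitivity (v * y'.2 * y.2 * (u * (x'.1 * x.2)) +
              u * x'.2 * x.2 * (v * (y'.1 * y.2))); first by ring.
by rewrite ex ey; ring.
Qed.

Lemma loc_mulE x y :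
  loc_mul (locclass x) (locclass y) = locclass (locfrac_mul x y).
Proof.
apply/locclassP/loceqP.
have := loceq_repr x; have := loceq_repr y.
move: (repr (locclass x)) (repr (locclass y)) => x' y' /loceqP[v vp ey] /loceqP[u up ex].
exists (u * v) => /=; first exact: locdenM.
transitivity ((u * (x'.1 * x.2)) * (v * (y'.1 * y.2))); first by ring.
by rewrite ex ey; ring.
Qed.

Let locE := (loc_oppE, loc_scaleE, loc_addE, loc_mulE).

Lemma locclass_eq x y : x.1 * y.2 = y.1 * x.2 -> locclass x = locclass y.
Proof.
by move=> e; apply/locclassP/loceqP; exists 1; rewrite ?e //; exact: locden1P.
Qed.

Lemma loc_addA : associative loc_add.
Proof.
elim/locclassW => x; elim/locclassW => y; elim/locclassW => z; rewrite !locE.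
by apply: locclass_eq => /=; ring.
Qed.

Lemma loc_addC : commutative loc_add.
Proof.
elim/locclassW => x; elim/locclassW => y; rewrite !locE.
by apply: locclass_eq => /=; ring.
Qed.

Lemma loc_add0 : left_id (locclass locfrac0) loc_add.
Proof. by elim/locclassW => x; rewrite !locE; apply: locclass_eq => /=; ring. Qed.

Lemma loc_addN : left_inverse (locclass locfrac0) loc_opp loc_add.
Proof. by elim/locclassW => x; rewrite !locE; apply: locclass_eq => /=; ring. Qed.

HB.instance Definition _ :=
  GRing.isZmodule.Build localring loc_addA loc_addC loc_add0 loc_addN.

Lemma loc_mulA : associative loc_mul.
Proof.
elim/locclassW => x; elim/locclassW => y; elim/locclassW => z; rewrite !locE.
by apply: locclass_eq => /=; ring.
Qed.

Lemma loc_mulC : commutative loc_mul.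
Proof.
elim/locclassW => x; elim/locclassW => y; rewrite !locE.
by apply: locclass_eq => /=; ring.
Qed.

Lemma loc_mul1 : left_id (locclass locfrac1) loc_mul.
Proof. by elim/locclassW => x; rewrite !locE; apply: locclass_eq => /=; ring. Qed.

Lemma loc_mulDl : left_distributive loc_mul loc_add.
Proof.
elim/locclassW => x; elim/locclassW => y; elim/locclassW => z; rewrite !locE.
by apply: locclass_eq => /=; ring.
Qed.

Lemma loc_oner_neq0 : locclass locfrac1 != locclass locfrac0.
Proof.
apply/eqP => /locclassP/loceqP[u up] /=.
rewrite mul0r mulr0 !mulr1 => u0; move: up.
by rewrite u0 -topredE /= [p 0]idealr0.
Qed.

HB.instance Definition _ := GRing.Zmodule_isComNzRing.Build localring
  loc_mulA loc_mulC loc_mul1 loc_mulDl loc_oner_neq0.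

Lemma loc_scaleA c d a : loc_scale c (loc_scale d a) = loc_scale (c * d) a.
Proof.
by elim/locclassW: a => x; rewrite !locE; apply: locclass_eq => /=;
   rewrite scalerA.
Qed.

Lemma loc_scale1 : left_id 1 loc_scale.
Proof.
by elim/locclassW => x; rewrite !locE; apply: locclass_eq => /=;
   rewrite scale1r.
Qed.

Lemma loc_scaleDr : right_distributive loc_scale +%R.
Proof.
move=> c; elim/locclassW => x; elim/locclassW => y.
rewrite [_ + _ in LHS]loc_addE !locE [RHS]loc_addE; apply: locclass_eq => /=.
by rewrite -!scalerAl -scalerDr -!scalerAl.
Qed.

Lemma loc_scaleDl a : {morph loc_scale^~ a : c d / c + d}.
Proof.
move=> c d; elim/locclassW: a => x; rewrite !locE [RHS]loc_addE.
by apply: locclass_eq => /=; rewrite scalerDl -mulrDl mulrA.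
Qed.

HB.instance Definition _ := GRing.Zmodule_isLmodule.Build k localring
  loc_scaleA loc_scale1 loc_scaleDr loc_scaleDl.

Lemma loc_scaleAl (c : k) (a b : localring) : c *: (a * b) = (c *: a) * b.
Proof.
elim/locclassW: a => x; elim/locclassW: b => y.
rewrite [_ * _ in LHS]loc_mulE [LHS]loc_scaleE.
rewrite [_ *: _ in RHS]loc_scaleE [RHS]loc_mulE.
by apply: locclass_eq => /=; rewrite scalerAl.
Qed.

HB.instance Definition _ :=
  GRing.Lmodule_isLalgebra.Build k localring loc_scaleAl.
HB.instance Definition _ := GRing.Lalgebra_isComAlgebra.Build k localring.

Definition locmax : {pred localring} :=
  [pred a | `[< exists2 x : locfrac, x.1 \in p & a = locclass x >]].

Lemma locmax_submod_closed : submod_closed locmax.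
Proof.
split=> [|c a b]; rewrite !inE.
  by apply/asboolP; exists locfrac0 => //=; rewrite -topredE /= [p 0]idealr0.
move=> /asboolP[x xp ->] /asboolP[y yp ->]; apply/asboolP.
exists (locfrac_add (locfrac_scale c x) y) => /=; last first.
  by rewrite -loc_addE -loc_scaleE.
have pM (u v : A) : u \in p -> u * v \in p.
  by move=> up; rewrite -topredE /= [p _]prime_idealrM; apply/orP; left.
have cxp : c *: x.1 \in p by rewrite -[x.1]mulr1 scalerAr; exact: pM.
by apply: (@rpredD _ p); exact: pM.
Qed.

HB.instance Definition _ :=
  GRing.isSubmodClosed.Build k localring locmax locmax_submod_closed.

(* The square of the ideal locmax, as a subspace of locmax *)
Definition locmax_sq : {pred submodule locmax} :=
  [pred a | `[< exists (n : nat) (x y : 'I_n -> submodule locmax),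
      val a = \sum_i val (x i) * val (y i) >]].

Lemma locmax_sq_submod_closed : submod_closed locmax_sq.
Proof.
split=> [|c a b]; rewrite !inE.
  by apply/asboolP; exists 0%N, (fun=> 0), (fun=> 0); rewrite big_ord0.
move=> /asboolP[n [x [y axy]]] /asboolP[m [z [w bzw]]]; apply/asboolP.
exists (n + m)%N.
exists (fun i => match fintype.split i with inl i => c *: x i | inr j => z j end).
exists (fun i => match fintype.split i with inl i => y i | inr j => w j end).
rewrite big_split_ord linearP /= axy bzw scaler_sumr.
congr (_ + _); apply: eq_bigr => i _.
  by have := @unsplitK n m (inl i) => /= ->; exact: scalerAl.
by have := @unsplitK n m (inr i) => /= ->.
Qed.

HB.instance Definition _ := GRing.isSubmodClosed.Build k (submodule locmax)
  locmax_sq locmax_sq_submod_closed.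

Definition cotangent_space : lmodType k := quotmod locmax_sq.

(* Linear forms are taken over k: p is meant to be a k-rational point, so that
   its residue field is k. *)
Definition tangent_space : lmodType k := dual cotangent_space.

End Localization.

Record graph : Type := Graph {
  vertex : finType;
  oedge : finType;
  einv : oedge -> oedge;
  src : oedge -> vertex;
  tgt : oedge -> vertex;
  einvK : involutive einv;
  einv_neq : forall e, einv e != e;
  src_einv : forall e, src e = tgt (einv e)
}.

Section Circuits.
Context (G : graph).

(* A pair of a set of vertices and a set of oriented edges *)
Definition subgraph : Type := ({set vertex G} * {set oedge G})%type.

Implicit Type H : subgraph.

Definition is_subgraph H : bool :=
  [forall e in H.2, [&& einv e \in H.2, src e \in H.1 & tgt e \in H.1]].

Definition edges_of (F : {set oedge G}) : {set {set oedge G}} :=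
  [set [set e; einv e] | e in F].

Definition adjacent (F : {set oedge G}) : rel (vertex G) :=
  fun u v => [exists e in F, (src e == u) && (tgt e == v)].

Definition is_connected H : bool :=
  (H.1 != set0) &&
  [forall u in H.1, forall v in H.1, connect (adjacent H.2) u v].

Definition remove_edge H (e : oedge G) : subgraph :=
  (H.1, H.2 :\: [set e; einv e]).

(* For connected H *)
Definition separating H (e : oedge G) : bool :=
  ~~ is_connected (remove_edge H e).

Definition b1 H : int := #|edges_of H.2|%:Z - #|H.1|%:Z + 1.

Definition is_circuit H : bool :=
  [&& is_subgraph H, is_connected H,
      [forall e in H.2, ~~ separating H e] & b1 H == 1].

Definition edges : {set {set oedge G}} := edges_of [set: oedge G].

Definition circuits : {set subgraph} := [set H : subgraph | is_circuit H].

Definition loops : {set subgraph} :=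
  [set H in circuits | #|edges_of H.2| == 1%N].

Lemma loops_sub_circuits : loops \subset circuits.
Proof. by apply/subsetP => H; rewrite inE => /andP[]. Qed.

End Circuits.

Section Semigroup.
Context (G : graph).

Definition vertex_basis (v : vertex G) : {ffun vertex G -> int} :=
  [ffun w => (w == v)%:R].

Definition boundary (c : {ffun oedge G -> int}) : {ffun vertex G -> int} :=
  \sum_e (vertex_basis (tgt e) - vertex_basis (src e)) *~ c e.

Definition oriented_homology : {pred {ffun oedge G -> int}} :=
  [pred c | boundary c == 0].

Definition effective : {pred {ffun oedge G -> int}} :=
  [pred c | (c \in oriented_homology) && [forall e, 0 <= c e]].

Record semigroup : Type :=
  Semigroup { cycle_val :> {ffun oedge G -> int}; _ : cycle_val \in effective }.

HB.instance Definition _ := [isSub for cycle_val].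
HB.instance Definition _ := [Choice of semigroup by <:].

Lemma effective0 : 0 \in effective.
Proof.
rewrite !inE; apply/andP; split; last by apply/forallP => e; rewrite ffunE.
by apply/eqP; rewrite /boundary big1 // => e _; rewrite ffunE mulr0z.
Qed.

Lemma effectiveD c d : c \in effective -> d \in effective ->
  c + d \in effective.
Proof.
rewrite !inE => /andP[/eqP bc /forallP pc] /andP[/eqP bd /forallP pd].
apply/andP; split; last by apply/forallP => e; rewrite ffunE addr_ge0.
apply/eqP; rewrite -[0]addr0 -{1}bc -bd /boundary -big_split /=.
by apply: eq_bigr => e _; rewrite ffunE mulrzDr.
Qed.

Lemma semigroup_valP (c : semigroup) : cycle_val c \in effective.
Proof. by case: c. Qed.

Definition semigroup0 : semigroup := Semigroup effective0.
Definition semigroupD (c d : semigroup) : semigroup :=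
  Semigroup (effectiveD (semigroup_valP c) (semigroup_valP d)).

Lemma semigroupDA : associative semigroupD.
Proof. by move=> c d e; apply: val_inj; rewrite /= addrA. Qed.

Lemma semigroupDC : commutative semigroupD.
Proof. by move=> c d; apply: val_inj; rewrite /= addrC. Qed.

Lemma semigroup0D : left_id semigroup0 semigroupD.
Proof. by move=> c; apply: val_inj; rewrite /= add0r. Qed.

Lemma semigroupD0 : right_id semigroup0 semigroupD.
Proof. by move=> c; apply: val_inj; rewrite /= addr0. Qed.

Lemma semigroup_pointed c d :
  semigroupD c d = semigroup0 -> c = semigroup0 /\ d = semigroup0.
Proof.
move=> /(congr1 cycle_val) /= cd0.
have := semigroup_valP c; rewrite inE => /andP[_ /forallP pc].
have := semigroup_valP d; rewrite inE => /andP[_ /forallP pd].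
have cd e : (c e == 0) && (d e == 0).
  by rewrite -paddr_eq0 //; have /ffunP/(_ e) := cd0; rewrite !ffunE => ->.
by split; apply/val_inj/ffunP => e; rewrite /= ffunE; apply/eqP;
   have /andP[] := cd e.
Qed.

(* monalg writes monoids multiplicatively: mone is the zero cycle and mmul is
   the addition of cycles. *)
HB.instance Definition _ := Choice_isMonomialDef.Build semigroup
  semigroupDA semigroup0D semigroupD0 semigroup_pointed.
HB.instance Definition _ :=
  MonomialDef_isConomialDef.Build semigroup semigroupDC.

End Semigroup.

Section CographicVariety.
Context (k : fieldType) (G : graph).

Definition semigroup_algebra : comAlgType k := {malg k[semigroup G]}.

(* Elements in which X^0 does not occur, i.e. the span of the X^c, c != 0 *)
Definition origin_ideal : {pred semigroup_algebra} :=
  [pred x : {malg k[semigroup G]} | mone \notin msupp x].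

Lemma origin_idealE (x : {malg k[semigroup G]}) :
  (x \in origin_ideal) = (x@_mone == 0).
Proof. by rewrite inE mcoeff_eq0. Qed.

Lemma origin_idealr_closed : idealr_closed origin_ideal.
Proof.
split; first by rewrite origin_idealE mcoeff0.
  by rewrite origin_idealE rmorph1 oner_eq0.
move=> a x y; rewrite !origin_idealE => /eqP x0 /eqP y0.
by rewrite rmorphD rmorphM /= x0 y0 mulr0 addr0.
Qed.

HB.instance Definition _ :=
  isIdealr.Build semigroup_algebra origin_ideal origin_idealr_closed.

Lemma origin_prime_closed : prime_idealr_closed origin_ideal.
Proof. by move=> x y; rewrite !origin_idealE rmorphM mulf_eq0. Qed.

HB.instance Definition _ :=
  isPrimeIdealrClosed.Build semigroup_algebra origin_ideal origin_prime_closed.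

Definition cographic_variety : Type := Spec semigroup_algebra.

Definition torus_fixed_point : cographic_variety := origin_ideal.

End CographicVariety.

(* Main.v *)
Require Import Defs.
From mathcomp Require Import all_boot all_algebra.
From mathcomp Require Import all_order ring.
From mathcomp Require Import generic_quotient ring_quotient.
From mathcomp Require Import boolp functions.
From mathcomp Require Import finmap monalg.

(** The tangent space is dual to the cotangent space [m / m^2] of the local ring
at the origin, and that space has the classes of the monomials [X^c], [c] an
indecomposable element of the semigroup, as a basis. They span
([cotangent_form_ext]): a denominator may be replaced by its constant term
modulo [m^2], and a decomposition [c = d + e] puts [X^c = X^d X^e] in [m^2].
They are independent ([coefficient_form]): for indecomposable [c], the
coefficient of [X^c] is a derivation at the origin, hence a linear form on
[m / m^2]. So the dimension is the number of indecomposable effective cycles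
([tangent_space_dim]).

The support of a nonzero effective cycle contains a directed simple cycle
(dicycle), because flow that enters a vertex must leave it, and the indicator of
this dicycle can be subtracted. Hence the indecomposable elements are exactly
the indicators of dicycles ([indecomposable_indicator] and
[indicator_indecomposable]).

It remains to count dicycles ([card_dicycles]). Those that contain some edge
together with its inverse are the pairs [{e, einv e}] with [e] not a loop, since
for a loop [{e}] alone is a dicycle; there are [|E| - |Loops|] of them. The
others are the orientations of circuits, two for each circuit
([card_avoiding_dicycles]). A circuit is given as a connected graph without
separating edges and with as many edges as vertices, and one has to find the
cycle in it. It contains a dicycle, as the ends of an edge remain connected
without that edge ([circuit_dicycle]). It has no edge outside this dicycle,
since deleting such an edge and then an edge of the dicycle would leave it
connected with fewer edges than a spanning tree ([circuit_support]). *)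

Set Implicit Arguments.
Unset Strict Implicit.
Unset Printing Implicit Defensive.

Import Order.TTheory GRing.Theory Num.Theory.

(** * Indecomposable exponents in a monoid algebra *)

Section Product.
Local Open Scope ring_scope.
Context {R : comNzRingType} {K : conomType}.
Implicit Types (c d e : K) (x y : {malg R[K]}).

Definition indecomposable c : Prop :=
  c <> mone /\ forall d e, c = mmul d e -> d = mone \/ e = mone.

Lemma mkmalgUM d e : mkmalgU d 1 * mkmalgU e 1 = mkmalgU (mmul d e) 1 :> {malg R[K]}.
Proof. by rewrite [LHS]fgmulUU mulr1. Qed.

Lemma mkmalgUZ (a : R) d : a *: mkmalgU d 1 = mkmalgU d a.
Proof. by apply/malgP=> c; rewrite mcoeffZ !mcoeffU mulrnAr mulr1. Qed.

Lemma mcoeff_mulU c : indecomposable c -> forall (a b : R) d e,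
  (mkmalgU d a * mkmalgU e b : {malg R[K]})@_c =
  (mkmalgU d a)@_c * (mkmalgU e b)@_mone + (mkmalgU d a)@_mone * (mkmalgU e b)@_c.
Proof.
move=> [c1 irr] a b d e; rewrite [X in X@__]fgmulUU !mcoeffU.
have := irr d e.
have [->|d1] := eqVneq d mone.
  rewrite mul1m (negbTE (_ : mone != c)); last by rewrite eq_sym; apply/eqP.
  by rewrite mul0r add0r mulr1n mulrnAr.
have [->|e1] := eqVneq e mone.
  rewrite mulm1 (negbTE (_ : mone != c)); last by rewrite eq_sym; apply/eqP.
  by rewrite mulr0 addr0 mulr1n mulrnAl.
rewrite !mulr0n mulr0 mul0r addr0; case: eqP => // <- /(_ erefl).
by case=> E; [rewrite E eqxx in d1 | rewrite E eqxx in e1].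
Qed.

(** An indecomposable exponent arises in a product only from the constant term
of one of the factors, so its coefficient is a derivation at the origin. *)
Lemma mcoeff_indecomposableM c x y : indecomposable c ->
  (x * y)@_c = x@_c * y@_mone + x@_mone * y@_c.
Proof.
move=> irr; rewrite {1}(monalgE x) {1}(monalgE y) mulr_suml raddf_sum /=.
under eq_bigr => d _.
  rewrite mulr_sumr raddf_sum /=.
  under eq_bigr do rewrite (mcoeff_mulU irr).
  rewrite big_split /= -!mulr_sumr -!raddf_sum -!monalgE. over.
by rewrite big_split /= -!mulr_suml -!raddf_sum -!monalgE.
Qed.

End Product.

(** * The cotangent space at a rational point *)

Section Quotient.
Local Open Scope ring_scope.

Lemma linear_form0 (k : nzRingType) (V : lmodType k) (f : V -> k^o) :
  linear f -> f 0 = 0.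
Proof.
by move=> lf; have := lf (-1) 0 0; rewrite !scaleN1r addNr => ->; rewrite addNr.
Qed.

Context {k : nzRingType} {V : lmodType k} {W : submodClosed V}.
Local Notation proj := (@quotmod_proj k V W).

Lemma quotmod_proj_linear : linear proj.
Proof. by move=> a u v; rewrite quotmod_projD -quotmod_projZ. Qed.

Lemma quotmod_proj_eq0 (u : V) : u \in W -> proj u = 0.
Proof.
move=> uW; transitivity (proj 0); first by apply/quotmod_projE; rewrite subr0.
by apply: (addrI (proj 0)); rewrite -quotmod_projD !addr0.
Qed.

Lemma quotmod_proj_surj (u : quotmod W) : exists v, u = proj v.
Proof. by apply: (quotmod_projW (P := fun u => exists v, u = proj v)) => v; exists v. Qed.

Lemma quotmod_form_sum (f : quotmod W -> k^o) (I : Type) (r : seq I)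
    (a : I -> k) (v : I -> V) : linear f ->
  f (proj (\sum_(i <- r) a i *: v i)) = \sum_(i <- r) a i *: f (proj (v i)).
Proof.
move=> lf; elim: r => [|i r IHr]; last first.
  by rewrite !big_cons quotmod_proj_linear lf IHr.
rewrite !big_nil quotmod_proj_eq0 ?rpred0 //.
exact: linear_form0.
Qed.

End Quotient.

Section Localization.
Local Open Scope ring_scope.
Context {k : fieldType} {A : comAlgType k} (p : Spec A).
Implicit Types (x y : A) (z : locfrac p).
Local Notation L := (localring p).
Local Notation M := (submodule (locmax (p := p))).

Definition tolocal x : L := locclass (@LocFrac _ A p (x, 1) (locden1P p)).

Lemma tolocalD : {morph tolocal : x y / x + y}.
Proof.
by move=> x y; rewrite [RHS]loc_addE; apply: locclass_eq => /=; rewrite !mulr1.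
Qed.

Lemma tolocalM : {morph tolocal : x y / x * y}.
Proof.
by move=> x y; rewrite [RHS]loc_mulE; apply: locclass_eq => /=; rewrite !mulr1.
Qed.

Lemma tolocalZ a x : tolocal (a *: x) = a *: tolocal x.
Proof. by rewrite [RHS]loc_scaleE; apply: locclass_eq. Qed.

Lemma tolocal_sum (I : Type) (r : seq I) (F : I -> A) :
  tolocal (\sum_(i <- r) F i) = \sum_(i <- r) tolocal (F i).
Proof. exact: (big_morph tolocal tolocalD (erefl : tolocal 0 = 0)). Qed.

Lemma locmaxP (a : L) :
  reflect (exists2 z : locfrac p, z.1 \in p & a = locclass z) (a \in locmax (p := p)).
Proof. by rewrite inE; apply: asboolP. Qed.

Lemma tolocal_locmax x : x \in p -> tolocal x \in locmax (p := p).
Proof. by move=> xp; apply/locmaxP; eexists; last by []; exact: xp. Qed.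

Lemma locmax_sqM (m n q : M) : val m = val n * val q -> m \in locmax_sq (p := p).
Proof.
by move=> mE; rewrite inE; apply/asboolP; exists 1%N, (fun=> n), (fun=> q); rewrite big_ord1.
Qed.

Lemma tolocalM_sq x y (m : M) :
  x \in p -> y \in p -> val m = tolocal (x * y) -> m \in locmax_sq (p := p).
Proof.
move=> xp yp mE.
apply: (@locmax_sqM _ (Submodule (tolocal_locmax xp)) (Submodule (tolocal_locmax yp))).
by rewrite mE tolocalM.
Qed.

Lemma prime_scale a x : x \in p -> a *: x \in p.
Proof.
have -> : a *: x = a%:A * x by rewrite -scalerAl mul1r.
by move=> xp; rewrite -topredE /= [p _]prime_idealrM; apply/orP; right.
Qed.

(** Modulo the square of the maximal ideal, a denominator may be replaced by its
value [s] at [p], as [x / z - x / s = x * ((s - z) / (s * z))]. *)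
Lemma cotangent_numerator (m : M) z (s : k) :
  z.1 \in p -> val m = locclass z -> s != 0 -> s%:A - z.2 \in p ->
  exists2 n : M, val n = tolocal z.1 & m - s^-1 *: n \in locmax_sq (p := p).
Proof.
move=> zp mz s0 sp.
exists (Submodule (tolocal_locmax zp)) => //.
have rz : locclass (@LocFrac _ A p (s^-1 *: (s%:A - z.2), z.2) (locdenP z))
    \in locmax (p := p).
  apply/locmaxP; eexists; last by [].
  exact: prime_scale.
apply: (@locmax_sqM _ (Submodule (tolocal_locmax zp)) (Submodule rz)).
transitivity (val m - s^-1 *: tolocal z.1); first by rewrite raddfB linearZ.
rewrite mz -tolocalZ; apply: (addIr (tolocal (s^-1 *: z.1))); rewrite subrK.
rewrite [X in _ = X + _]loc_mulE [RHS]loc_addE; apply: locclass_eq => /=.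
rewrite !mulr1 mul1r scalerBr scalerA mulVf // scale1r mulrBr mulr1.
by rewrite -scalerAr -scalerAl subrK.
Qed.

End Localization.

Section PointDerivation.
Local Open Scope ring_scope.
Context {k : fieldType} {A : comAlgType k} (p : Spec A) (ev der : A -> k).
Context (ev_mem : forall x, (x \in p) = (ev x == 0)).
Context (evM : {morph ev : x y / x * y}) (ev1 : ev 1 = 1).
Context (der_linear : forall a x y, der (a *: x + y) = a * der x + der y).
Context (derM : forall x y, der (x * y) = der x * ev y + ev x * der y).
Implicit Types (x y : A) (z : locfrac p).
Local Notation M := (submodule (locmax (p := p))).
Local Notation proj := (@quotmod_proj k M (locmax_sq (p := p))).

(** The quotient rule at [p], for a fraction whose numerator vanishes at [p]. *)
Definition locder (a : localring p) : k := der (repr a).1 / ev (repr a).2.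

Lemma ev_locden z : ev z.2 != 0.
Proof. by rewrite -ev_mem locdenP. Qed.

Lemma locderE z : z.1 \in p -> locder (locclass z) = der z.1 / ev z.2.
Proof.
rewrite ev_mem /locder => /eqP z1; have /loceqP[u] := loceq_repr z.
move: (repr (locclass z)) => y; rewrite ev_mem => u0 e.
have y1 : ev y.1 = 0.
  have /eqP := congr1 ev e; rewrite !evM z1 mul0r mulr0.
  by rewrite !mulf_eq0 (negbTE u0) (negbTE (ev_locden z)) orbF => /eqP.
have := congr1 der e; rewrite !derM !evM y1 z1 !mul0r !mulr0 !add0r !addr0.
by move=> /(mulfI u0) e'; apply/eqP; rewrite eqr_div ?ev_locden // e'.
Qed.

Lemma locder_linear a (m n : M) :
  locder (val (a *: m + n)) = a * locder (val m) + locder (val n).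
Proof.
rewrite (_ : val (_ + _) = a *: val m + val n); last by rewrite linearP.
have /locmaxP[y yp ->] := valP m; have /locmaxP[z zp ->] := valP n.
rewrite [X in locder (X + _)]loc_scaleE [X in locder X]loc_addE.
have ayp := prime_scale a yp.
have y2 := ev_locden y; have z2 := ev_locden z.
have derZ x : der (a *: x) = a * der x.
  have der0 : der 0 = 0.
    by have := der_linear (-1) 0 0; rewrite scaleN1r addNr mulN1r addNr.
  by rewrite -[a *: x]addr0 der_linear der0 addr0.
have derD x x' : der (x + x') = der x + der x'.
  by rewrite -[x]scale1r der_linear mul1r scale1r.
rewrite !locderE //; last first.
  by apply: (@rpredD _ p); rewrite ev_mem evM; [move: ayp|move: zp];
    rewrite ev_mem => /eqP->; rewrite mul0r.
move: ayp zp; rewrite !ev_mem /= derD !derM !evM derZ => /eqP-> /eqP->.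
by rewrite !mul0r !addr0; field; rewrite y2 z2.
Qed.

(** Both factors vanish at [p], so the product rule leaves nothing. *)
Lemma locder_sq (m : M) : m \in locmax_sq (p := p) -> locder (val m) = 0.
Proof.
rewrite inE => /asboolP[n [x [y mE]]].
have mulP (u v : M) : exists2 z : locfrac p, z.1 \in p & val u * val v = locclass z /\ der z.1 = 0.
  have /locmaxP[a + ->] := valP u; have /locmaxP[b + ->] := valP v.
  rewrite !ev_mem => /eqP b0 /eqP a0; exists (locfrac_mul a b); last split.
  - by rewrite ev_mem /= evM a0 mul0r.
  - exact: loc_mulE.
  - by rewrite /= derM a0 b0 mulr0 mul0r addr0.
have mulM (u v : M) : val u * val v \in locmax (p := p).
  by have [z zp [-> _]] := mulP u v; apply/locmaxP; exists z.
have {mE} -> : m = \sum_i Submodule (mulM (x i) (y i)).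
  by apply: val_inj; rewrite mE raddf_sum.
elim/big_ind: _ => [|u v u0 v0|i _].
- by have := locder_linear (-1) 0 0; rewrite scaleN1r addNr mulN1r addNr.
- by rewrite -[u]scale1r locder_linear u0 v0 mulr0 addr0.
by rewrite /=; have [z zp [-> dz]] := mulP (x i) (y i); rewrite locderE // dz mul0r.
Qed.

(** A derivation at [p] extends to the local ring by the quotient rule, and
kills the square of the maximal ideal. *)
Lemma derivation_form : exists2 f : cotangent_space p -> k^o, linear f &
  forall x (m : M), x \in p -> val m = tolocal p x -> f (proj m) = der x.
Proof.
pose f (u : cotangent_space p) : k^o := locder (val (repr u)).
have fE m : f (proj m) = locder (val m).
  rewrite /f; set n := repr _.
  have nm : n - m \in locmax_sq (p := p).
    by apply/quotmod_projE; rewrite /n /quotmod_proj reprK.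
  rewrite -[n](subrK m) -[n - m]scale1r locder_linear (locder_sq nm).
  by rewrite mulr0 add0r.
exists f => [a u v|x m xp mE].
  have [m ->] := quotmod_proj_surj u; have [n ->] := quotmod_proj_surj v.
  by rewrite -quotmod_proj_linear !fE locder_linear.
by rewrite fE mE locderE //= ev1 divr1.
Qed.

End PointDerivation.

(** * The cotangent space at the torus fixed point *)

Section Tangent.
Local Open Scope ring_scope.
Context (k : fieldType) (G : graph).
Implicit Types (c d : semigroup G).
Local Notation A := (semigroup_algebra k G).
Local Notation o := (torus_fixed_point k G).
Implicit Types (x y : A).
Local Notation M := (submodule (locmax (p := o))).

Lemma origin_memE x : (x \in o) = ((x : {malg k[semigroup G]})@_mone == 0).
Proof. exact: origin_idealE. Qed.

Lemma monomial_in_origin c : c != mone -> (mkmalgU c 1 : A) \in o.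
Proof. by move=> c1; rewrite origin_memE mcoeffU (negbTE c1). Qed.

(** Made total by the value [0] at the neutral exponent, as [X^0] lies outside
the maximal ideal. *)
Definition locmonomial c : M := insubd 0 (tolocal o (mkmalgU c 1)).

Lemma val_locmonomial c : c != mone -> val (locmonomial c) = tolocal o (mkmalgU c 1).
Proof. by move=> c1; rewrite val_insubd tolocal_locmax // monomial_in_origin. Qed.

Lemma val_sum_locmonomial x (n : M) : x \in o -> val n = tolocal o x ->
  n = \sum_(c <- msupp (x : {malg k[semigroup G]}))
        (x : {malg k[semigroup G]})@_c *: locmonomial c.
Proof.
move=> xo nx; apply: val_inj; rewrite nx raddf_sum /=.
rewrite {1}(monalgE x) tolocal_sum; apply: eq_big_seq => c cx.
have c1 : c != mone.
  by apply: contraTneq cx => ->; rewrite -mcoeff_eq0 -origin_memE.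
transitivity ((x : {malg k[semigroup G]})@_c *: val (locmonomial c)); last by rewrite -linearZ.
by rewrite val_locmonomial // -tolocalZ -mkmalgUZ.
Qed.

(** A decomposition of [c] writes [X^c] as a product of two elements of the
maximal ideal. *)
Lemma locmonomial_decomposable c : c != mone -> ~ indecomposable c ->
  locmonomial c \in locmax_sq (p := o).
Proof.
move=> c1 irr.
have [d [e [ce d1 e1]]] : exists d e, [/\ c = mmul d e, d != mone & e != mone].
  apply: contrapT => nde; apply: irr; split=> [|d e ce]; first exact/eqP.
  have [->|d1] := eqVneq d mone; first by left.
  have [->|e1] := eqVneq e mone; first by right.
  by case: nde; exists d, e.
apply: (tolocalM_sq (monomial_in_origin d1) (monomial_in_origin e1)).
rewrite val_locmonomial // ce; congr (tolocal o _).
exact: esym (mkmalgUM d e).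
Qed.

Local Notation proj := (@quotmod_proj k M (locmax_sq (p := o))).

(** The monomials with indecomposable exponents span the cotangent space: once
denominators are cleared, the other monomials vanish. *)
Lemma cotangent_form_ext (phi psi : cotangent_space o -> k^o) :
  linear phi -> linear psi ->
  (forall c, indecomposable c -> phi (proj (locmonomial c)) = psi (proj (locmonomial c))) ->
  phi = psi.
Proof.
move=> lphi lpsi eq_irr.
apply/funext => u; have [m ->] := quotmod_proj_surj u.
have /locmaxP[z zo mz] : val m \in locmax (p := o) by apply: valP.
have s0 : (z.2 : {malg k[semigroup G]})@_mone != 0.
  by have := locdenP z; rewrite origin_memE.
have [|n nz mn] := cotangent_numerator zo mz s0.
  by rewrite origin_memE mcoeffB mcoeffZ mcoeff1 eqxx mulr1 subrr.
have /quotmod_projE -> := mn.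
rewrite (val_sum_locmonomial zo nz) scaler_sumr.
under eq_bigr do rewrite scalerA.
rewrite !quotmod_form_sum //; apply: eq_big_seq => c cz; congr (_ *: _).
have c1 : c != mone.
  by apply: contraTneq cz => ->; rewrite -mcoeff_eq0 -origin_memE.
have [|nirr] := pselect (indecomposable c); first exact: eq_irr.
rewrite (quotmod_proj_eq0 (locmonomial_decomposable c1 nirr)).
by rewrite !linear_form0.
Qed.

(** These forms are dual to the indecomposable monomials, which are therefore
linearly independent. *)
Lemma coefficient_form c : indecomposable c ->
  exists2 f : cotangent_space o -> k^o, linear f &
    forall d, d != mone -> f (proj (locmonomial d)) = (d == c)%:R.
Proof.
move=> irr.
pose ev : A -> k := mcoeff mone; pose der : A -> k := mcoeff c.
have [] := @derivation_form k A o ev der.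
- exact: origin_memE.
- exact: (@rmorphM _ _ (mcoeff mone : {malg k[semigroup G]} -> k)).
- exact: (@rmorph1 _ _ (mcoeff mone : {malg k[semigroup G]} -> k)).
- by move=> a x y; rewrite /der mcoeffD mcoeffZ.
- by move=> x y; apply: mcoeff_indecomposableM.
move=> f lf fE; exists f => // d d1.
by rewrite (fE _ _ (monomial_in_origin d1) (val_locmonomial d1)) /der mcoeffU.
Qed.

(** A linear form corresponds to its values on the basis of indecomposable
monomials. *)
Lemma tangent_space_dim n (g : 'I_n -> semigroup G) :
  injective g -> (forall c, indecomposable c <-> exists i, c = g i) ->
  has_dim (tangent_space o) n.
Proof.
move=> g_inj gP; have irr i : indecomposable (g i) by apply/gP; exists i.
have g1 i : g i != mone by apply/eqP; case: (irr i).
constructor.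
exists (fun phi : tangent_space o => \row_i val phi (proj (locmonomial (g i)))).
  by move=> a phi psi; apply/rowP=> i; rewrite !mxE linearP.
have /all_sig2[f lf fE] i : {f : cotangent_space o -> k^o | linear f &
    forall d, d != mone -> f (proj (locmonomial d)) = (d == g i)%:R}.
  by apply/cid2/coefficient_form.
pose form (r : 'rV[k]_n) : cotangent_space o -> k^o :=
  fun u => \sum_i r 0 i *: f i u.
have form_linear r : form r \in linear_form (V := cotangent_space o).
  rewrite inE; apply/asboolP => a u v; rewrite /form scaler_sumr -big_split.
  apply: eq_bigr => i _; rewrite lf scalerDr !scalerA.
  by rewrite [a * _]mulrC.
have rowE r i : form r (proj (locmonomial (g i))) = r 0 i.
  rewrite /form (bigD1 i) //= fE // eqxx.
  rewrite big1 => [|j ji]; first by rewrite addr0; exact: mulr1.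
  rewrite fE // (inj_eq g_inj) eq_sym (negbTE ji); exact: mulr0.
exists (fun r => Submodule (form_linear r)) => [phi|r]; last first.
  by apply/rowP=> i; rewrite mxE /= rowE.
apply: val_inj => /=; apply: cotangent_form_ext.
- by have := form_linear (\row_i val phi (proj (locmonomial (g i)))); rewrite inE => /asboolP.
- by have := valP phi; rewrite inE => /asboolP.
by move=> c /gP[i ->]; rewrite rowE mxE.
Qed.

End Tangent.

(** * Directed simple cycles *)

Section Dicycles.
Context {G : graph}.
Implicit Types (e f g : oedge G) (A B F : {set oedge G}).

Lemma tgt_einv e : tgt (einv e) = src e.
Proof. by rewrite src_einv. Qed.

Lemma src_inv e : src (einv e) = tgt e.
Proof. by rewrite src_einv einvK. Qed.

Lemma einv_inj : injective (@einv G).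
Proof. exact: inv_inj (@einvK G). Qed.

Definition traversable F : bool :=
  (F != set0) && (@tgt G @: F \subset @src G @: F).

(** A directed simple cycle, given by its set of edges: inside a traversable set
one can walk on forever, hence around a cycle, so the minimal ones are the
simple cycles. A loop [{e}] is one, and so is an edge [{e, einv e}] that is not
a loop. *)
Definition dicycle F : bool := minset traversable F.

Lemma traversableP F :
  reflect (F != set0 /\ forall e, e \in F -> exists2 f, f \in F & src f = tgt e)
          (traversable F).
Proof.
apply: (iffP andP) => -[F0 h]; split=> //.
  by move=> e eF; have /imsetP[f fF ->] := subsetP h _ (imset_f _ eF); exists f.
by apply/subsetP=> _ /imsetP[e /h[f fF <-] ->]; apply: imset_f.
Qed.

Lemma dicycle_sub F F' : dicycle F -> dicycle F' -> F' \subset F -> F' = F.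
Proof. by move=> /minsetP[_ minF] /minsetP[tF' _]; apply: minF. Qed.

Lemma dicycle_neq0 F : dicycle F -> F != set0.
Proof. by case/minsetP => /traversableP[]. Qed.

Lemma dicycle_next F e :
  dicycle F -> e \in F -> exists2 f, f \in F & src f = tgt e.
Proof. by case/minsetP => /traversableP[_ h] _; apply: h. Qed.

(** Of two edges with the same start, one could be dropped. *)
Lemma dicycle_src_inj F : dicycle F -> {in F &, injective (@src G)}.
Proof.
move=> /minsetP[/traversableP[_ next] minF] e f eF fF sef.
apply/eqP/negPn/negP => nef.
suff /setP/(_ e) : F :\ e = F by rewrite setD11 eF.
apply: minF (subD1set _ _); apply/traversableP; split.
  by apply/set0Pn; exists f; rewrite in_setD1 eq_sym nef.
move=> g /setD1P[_ /next[h hF <-]].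
have [->|neh] := eqVneq h e; last by exists h => //; rewrite in_setD1 neh.
by exists f => //; rewrite in_setD1 eq_sym nef.
Qed.

(** Induction along the dicycle: a part closed under successors is traversable,
so minimality applies. *)
Lemma dicycle_closed F A :
  dicycle F -> A \subset F -> A != set0 ->
  (forall e f, e \in A -> f \in F -> src f = tgt e -> f \in A) -> A = F.
Proof.
move=> cF AF A0 closA; have /minsetP[_ minF] := cF.
apply: minF (AF); apply/traversableP; split=> // e eA.
by have [f fF sf] := dicycle_next cF (subsetP AF _ eA); exists f => //; apply: closA sf.
Qed.

(** The edges that have a predecessor are closed under successors. *)
Lemma dicycle_prev F e :
  dicycle F -> e \in F -> exists2 f, f \in F & tgt f = src e.
Proof.
move=> cF eF; pose A := [set f in F | src f \in @tgt G @: F].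
suff /setP/(_ e) : A = F.
  by rewrite inE eF /= => /imsetP[f fF ->]; exists f.
apply: (dicycle_closed cF).
- by apply/subsetP=> f /setIdP[].
- have [f fF sf] := dicycle_next cF eF.
  by apply/set0Pn; exists f; rewrite inE fF sf imset_f.
by move=> f g /setIdP[fF _] gF sg; rewrite inE gF sg imset_f.
Qed.

Lemma dicycle_tgt_src F : dicycle F -> @tgt G @: F = @src G @: F.
Proof.
move=> cF; apply/setP=> v; apply/imsetP/imsetP=> -[e eF ->].
  by have [f fF <-] := dicycle_next cF eF; exists f.
by have [f fF <-] := dicycle_prev cF eF; exists f.
Qed.

Lemma dicycle_tgt_inj F : dicycle F -> {in F &, injective (@tgt G)}.
Proof.
move=> cF; apply/imset_injP; rewrite dicycle_tgt_src //.
exact/imset_injP/dicycle_src_inj.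
Qed.

(** For minimality of the reverse: a part of [F] closed under predecessors has a
complement closed under successors, which is empty or [F]. *)
Lemma dicycle_rev F : dicycle F -> dicycle (@einv G @: F).
Proof.
move=> cF; apply/minsetP; split=> [|B /traversableP[B0 nextB] BF].
  apply/traversableP; split=> [|_ /imsetP[e eF ->]].
    by rewrite -card_gt0 card_imset ?card_gt0 ?dicycle_neq0 //; apply: einv_inj.
  have [f fF tf] := dicycle_prev cF eF.
  by exists (einv f); rewrite ?imset_f // src_inv tgt_einv.
have inB e : e \in B -> einv e \in F.
  by move=> /(subsetP BF)/imsetP[f fF ->]; rewrite einvK.
pose A := [set e in F | einv e \notin B].
have [A0|A0] := eqVneq A set0.
  apply/eqP; rewrite eqEsubset BF; apply/subsetP=> _ /imsetP[e eF ->].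
  by apply/negPn/negP=> eB; move/setP/(_ e): A0; rewrite !inE eF eB.
suff AF : A = F.
  have [b bB] := set0Pn _ B0; move: (inB _ bB); rewrite -{1}AF inE einvK bB.
  by rewrite andbF.
apply: (dicycle_closed cF) => //; first by apply/subsetP=> e /setIdP[].
move=> e f /setIdP[eF eB] fF sf; rewrite inE fF; apply: contra eB => fB.
have [b bB] := nextB _ fB; rewrite tgt_einv sf => tb.
have <- // : b = einv e.
apply: einv_inj; rewrite einvK; apply: (dicycle_tgt_inj cF) => //; first exact: inB.
by rewrite tgt_einv.
Qed.

Definition avoids_inverse F : bool := [disjoint F & @einv G @: F].

Lemma mem_einv_imset F e : (e \in @einv G @: F) = (einv e \in F).
Proof. by rewrite -{1}[e]einvK mem_imset //; apply: einv_inj. Qed.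

Lemma avoids_inverseP F :
  reflect (forall e, e \in F -> einv e \notin F) (avoids_inverse F).
Proof.
apply: (iffP pred0P) => h e; first by move=> eF; move: (h e); rewrite /= eF mem_einv_imset => /= ->.
by rewrite /= mem_einv_imset; apply/negP=> /andP[/h/negP eF /eF].
Qed.

Lemma edge_traversable e : traversable [set e; einv e].
Proof.
apply/traversableP; split=> [|f]; first by apply/set0Pn; exists e; rewrite set21.
by case/set2P=> ->; [exists (einv e); rewrite ?set22 ?src_inv
                    |exists e; rewrite ?set21 ?tgt_einv].
Qed.

Lemma dicycle_edge e : dicycle [set e; einv e] = (src e != tgt e).
Proof.
have [see|see] := eqVneq (src e) (tgt e).
  apply/negbTE/negP=> /dicycle_src_inj/(_ e (einv e)).
  rewrite set21 set22 src_inv see => /(_ isT isT erefl)/eqP.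
  by rewrite eq_sym (negbTE (einv_neq _)).
apply/minsetP; split=> [|B /traversableP[B0 nextB] BE]; first exact: edge_traversable.
have eB : e \in B -> einv e \in B.
  move=> /nextB[f fB sf]; have := subsetP BE _ fB; case/set2P=> ff; subst f => //.
  by rewrite sf eqxx in see.
have eB' : einv e \in B -> e \in B.
  move=> /nextB[f fB]; rewrite tgt_einv => sf.
  have := subsetP BE _ fB; case/set2P=> ff; subst f => //.
  by rewrite src_inv in sf; rewrite sf eqxx in see.
apply/eqP; rewrite eqEsubset BE; apply/subsetP.
have [b bB] := set0Pn _ B0; have := subsetP BE _ bB.
case/set2P=> bb; subst b => f; case/set2P=> -> //; auto.
Qed.

(** An edge and its inverse already form a traversable set. *)
Lemma dicycle_back_forth F e :
  dicycle F -> e \in F -> einv e \in F -> F = [set e; einv e].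
Proof.
move=> /minsetP[_ minF] eF ieF; apply/esym/minF; first exact: edge_traversable.
by apply/subsetP=> f /set2P[]->.
Qed.

Lemma dicycle_loop e : src e = tgt e -> dicycle [set e].
Proof.
move=> see; apply/minsetP; split=> [|B /traversableP[B0 _] Be].
  apply/traversableP; split=> [|f /set1P->]; first by rewrite -card_gt0 cards1.
  by exists e; rewrite ?set11.
by apply/eqP; rewrite eqEcard Be cards1 card_gt0.
Qed.

(** The edges of [F] whose start can be reached from the end of [e] without [e]
are closed under successors, so [e] is one of them. *)
Lemma dicycle_bypass F e : dicycle F -> e \in F ->
  connect (adjacent (F :\ e)) (tgt e) (src e).
Proof.
move=> cF eF.
pose A := [set f in F | connect (adjacent (F :\ e)) (tgt e) (src f)].
suff /setP/(_ e) : A = F by rewrite inE eF.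
apply: (dicycle_closed cF).
- by apply/subsetP=> f /setIdP[].
- have [f fF sf] := dicycle_next cF eF.
  by apply/set0Pn; exists f; rewrite inE fF sf connect0.
move=> f g /setIdP[fF cf] gF sg; rewrite inE gF sg.
have [->|nfe] := eqVneq f e; first exact: connect0.
apply: connect_trans cf (connect1 _); apply/existsP; exists f.
by rewrite in_setD1 nfe fF !eqxx.
Qed.

Lemma dicycle_connected F :
  dicycle F -> {in @src G @: F &, forall u v, connect (adjacent F) u v}.
Proof.
move=> cF _ _ /imsetP[e eF ->] /imsetP[f fF ->].
pose A := [set f in F | connect (adjacent F) (src e) (src f)].
suff /setP/(_ f) : A = F by rewrite inE fF.
apply: (dicycle_closed cF).
- by apply/subsetP=> g /setIdP[].
- by apply/set0Pn; exists e; rewrite inE eF connect0.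
move=> g h /setIdP[gF cg] hF sh; rewrite inE hF sh.
by apply: connect_trans cg (connect1 _); apply/existsP; exists g; rewrite gF !eqxx.
Qed.

End Dicycles.

(** * Circuits and their two orientations *)

(** Take for [d] the distance to [s]. *)
Lemma connect_potential (T : finType) (r : rel T) (s : T) :
  exists d : T -> nat, forall v : T, connect r v s -> v != s ->
    exists2 w, r v w & connect r w s && (d w < d v).
Proof.
pose P (v : T) n := `[< exists p, [/\ path r v p, s = last v p & size p = n] >].
exists (fun v : T => if pselect (exists n, P v n) is left h then ex_minn h else 0%N).
move=> v /connectP[p0 p0v sp0] vs.
case: pselect => [h|[]]; last by exists (size p0); apply/asboolP; exists p0.
case: ex_minnP => n /asboolP[[|w q] []] /=; first by move=> _ sv; rewrite sv eqxx in vs.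
move=> /andP[vw wq] sq <- _; exists w => //; apply/andP; split.
  by apply/connectP; exists q.
have Pw : P w (size q) by apply/asboolP; exists q.
case: pselect => [h'|[]]; last by exists (size q).
by case: ex_minnP => m _ /(_ _ Pw); rewrite ltnS.
Qed.

Section Circuits.
Context {G : graph}.
Implicit Types (e f : oedge G) (A F : {set oedge G}) (H : subgraph G).
Implicit Types (u v : vertex G).

Lemma is_subgraphP H :
  reflect (forall e, e \in H.2 -> [/\ einv e \in H.2, src e \in H.1 & tgt e \in H.1])
          (is_subgraph H).
Proof.
apply: (iffP forall_inP) => h e /h; first by case/and3P.
by case=> *; apply/and3P.
Qed.

Lemma is_connectedP H :
  reflect (H.1 != set0 /\ {in H.1 &, forall u v, connect (adjacent H.2) u v})
          (is_connected H).
Proof.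
apply: (iffP andP) => -[H0 h]; split=> //.
  by move=> u v uH vH; apply: (forall_inP (forall_inP h u uH)).
by apply/forall_inP=> u uH; apply/forall_inP=> v; apply: h.
Qed.

Lemma einv_pair e : [set einv e; einv (einv e)] = [set e; einv e].
Proof. by rewrite einvK setUC. Qed.

(** The unoriented edges partition the oriented ones into pairs. *)
Lemma card_edges_of A :
  (forall e, e \in A -> einv e \in A) -> #|A| = (2 * #|edges_of A|)%N.
Proof.
move=> invA; rewrite mulnC; apply: card_uniform_partition.
  move=> _ /imsetP[e _ ->]; rewrite cards2 eq_sym.
  by rewrite (negbTE (einv_neq e)).
have pair e f : f \in [set e; einv e] -> [set e; einv e] = [set f; einv f].
  by case/set2P=> -> //; rewrite einv_pair.
apply/and3P; split.
- rewrite eqEsubset; apply/andP; split; apply/subsetP=> f.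
    by case/bigcupP=> _ /imsetP[e eA ->]; case/set2P=> -> //; apply: invA.
  by move=> fA; apply/bigcupP; exists [set f; einv f]; [apply: imset_f | rewrite set21].
- apply/trivIsetP=> _ _ /imsetP[e _ ->] /imsetP[f _ ->]; apply: contraNT.
  by case/pred0Pn=> g /andP[/= /pair-> /pair->]; rewrite eqxx.
- by apply/imsetP=> -[e _ /setP/(_ e)]; rewrite set21 inE.
Qed.

Lemma card_circuit_edges H :
  is_subgraph H -> (b1 H == 1%R) = (#|H.2| == 2 * #|H.1|)%N.
Proof.
move=> /is_subgraphP sH; rewrite card_edges_of; last by move=> e /sH[].
by rewrite eqn_pmul2l // /b1 -[X in _ == X]add0r (inj_eq (addIr _)) subr_eq0.
Qed.

Lemma adjacent_sym A : (forall e, e \in A -> einv e \in A) ->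
  connect_sym (adjacent A).
Proof.
move=> invA; apply: sym_connect_sym => u v.
by apply/existsP/existsP=> -[e /and3P[eA /eqP<- /eqP<-]];
  exists (einv e); rewrite invA //= src_inv tgt_einv !eqxx.
Qed.

Lemma is_subgraph_remove H e : is_subgraph H -> is_subgraph (remove_edge H e).
Proof.
move=> /is_subgraphP sH; apply/is_subgraphP=> f /setDP[/sH[fH sf tf] nfe].
split=> //; rewrite inE /= fH andbT; apply: contra nfe.
by case/set2P=> ef; rewrite !inE; [rewrite -ef einvK | rewrite (einv_inj ef)]; rewrite eqxx ?orbT.
Qed.

Lemma card_remove_edge H e : is_subgraph H -> e \in H.2 ->
  #|H.2| = (#|(remove_edge H e).2| + 2)%N.
Proof.
move=> /is_subgraphP sH eH; rewrite (cardsD H.2 [set e; einv e]).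
have /setIidPr-> : [set e; einv e] \subset H.2.
  by apply/subsetP=> f /set2P[]-> //; case: (sH e eH).
have <- : #|[set e; einv e]| = 2 by rewrite cards2 eq_sym einv_neq.
rewrite subnK //; apply: subset_leq_card.
by apply/subsetP=> f /set2P[]-> //; case: (sH e eH).
Qed.

(** A connected graph has at least as many edges as a tree on its vertices: a
vertex set spanned by few edges grows along an edge leaving it. *)
Lemma connected_card H :
  is_subgraph H -> is_connected H -> 2 * #|H.1| <= #|H.2| + 2.
Proof.
move=> /is_subgraphP sH /is_connectedP[/set0Pn[r rH] cH].
pose inner (W : {set vertex G}) := [set e in H.2 | (src e \in W) && (tgt e \in W)].
pose thin (W : {set vertex G}) :=
  [&& r \in W, W \subset H.1 & 2 * #|W| <= #|inner W| + 2].
have r1 : thin [set r] by rewrite /thin set11 sub1set rH cards1 leq_addl.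
have [W /maxsetP[/and3P[rW WH Wthin] maxW] _] := maxset_exists r1.
suff -> : H.1 = W.
  by apply: leq_trans Wthin _; rewrite leq_add2r subset_leq_card //; apply/subsetP=> e /setIdP[].
apply/eqP; rewrite eqEsubset WH andbT; apply/subsetP=> v vH.
have out e : e \in H.2 -> src e \in W -> tgt e \in W.
  move=> eH sW; apply/negPn/negP=> tW; have [ieH _ tH] := sH e eH.
  suff /maxW/(_ (subsetUr _ _))/setP/(_ (tgt e)) : thin (tgt e |: W).
    by rewrite setU11 (negbTE tW).
  rewrite /thin !inE rW orbT subUset sub1set tH WH /= cardsU1 tW mulnDr.
  have sub : [set e; einv e] :|: inner W \subset inner (tgt e |: W).
    apply/subsetP=> f; rewrite !inE -orbA => /or3P[/eqP->|/eqP->|].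
    - by rewrite eH sW eqxx orbT.
    - by rewrite ieH src_inv tgt_einv eqxx sW orbT.
    - by case/and3P=> -> -> ->; rewrite !orbT.
  apply: leq_trans (leq_add (subset_leq_card sub) (leqnn 2)).
  rewrite cardsU cards2 eq_sym einv_neq (_ : _ :&: _ = set0); last first.
    apply/setP=> f; rewrite !inE; apply/negbTE/negP=> /andP[/orP[]/eqP-> /and3P[_]].
      by rewrite (negbTE tW).
    by rewrite src_inv (negbTE tW).
  by rewrite cards0 subn0 -addnA leq_add2l.
have clW : closed (adjacent H.2) W.
  apply: intro_closed.
    by apply: adjacent_sym => e /sH[].
  by move=> u w /existsP[e /and3P[eH /eqP<- /eqP<-]]; apply: out.
by rewrite -(closed_connect clW (cH r v rH vH)).
Qed.

(** An edge on a cycle is not separating: the rest of the cycle replaces it. *)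
Lemma dicycle_not_separating H F e :
  is_subgraph H -> is_connected H -> dicycle F -> avoids_inverse F ->
  F \subset H.2 -> e \in F -> ~~ separating H e.
Proof.
move=> sgH; have /is_subgraphP sH := sgH.
move=> /is_connectedP[H0 cH] cF /avoids_inverseP aF FH eF; rewrite negbK.
apply/is_connectedP; split=> // u v uH vH.
apply: connect_sub (cH u v uH vH) => {uH vH}u {}v /existsP[f /and3P[fH /eqP<- /eqP<-]].
have /is_subgraphP sR := is_subgraph_remove e sgH.
have byp : connect (adjacent (remove_edge H e).2) (tgt e) (src e).
  apply: connect_sub (dicycle_bypass cF eF) => {}u {}v.
  case/existsP=> g /and3P[/setD1P[nge gF] sg tg].
  apply/connect1/existsP; exists g; rewrite sg tg !inE (negbTE nge) (subsetP FH) //= andbT andbT.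
  by apply: contraL gF => /eqP->; apply: aF.
have [/set2P[]->|nfe] := boolP (f \in [set e; einv e]).
- by rewrite adjacent_sym // => g /sR[].
- by rewrite src_inv tgt_einv.
by apply/connect1/existsP; exists f; rewrite inE fH nfe !eqxx.
Qed.

Definition support_subgraph F : subgraph G := (@src G @: F, F :|: @einv G @: F).

Lemma support_subgraph_rev F :
  dicycle F -> support_subgraph (@einv G @: F) = support_subgraph F.
Proof.
move=> cF; rewrite /support_subgraph; congr pair.
  by rewrite -(dicycle_tgt_src cF) -imset_comp; apply: eq_imset => e /=; rewrite src_inv.
rewrite (_ : @einv G @: (@einv G @: F) = F) 1?setUC //.
by apply/setP=> e; rewrite !mem_einv_imset einvK.
Qed.

Lemma avoids_inverse_rev F : avoids_inverse F -> avoids_inverse (@einv G @: F).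
Proof.
move=> /avoids_inverseP aF; apply/avoids_inverseP=> e.
rewrite !mem_einv_imset => /aF; apply: contra; by rewrite einvK.
Qed.

Lemma support_subgraphP F : dicycle F -> is_subgraph (support_subgraph F).
Proof.
move=> cF; apply/is_subgraphP=> e; rewrite !inE !mem_einv_imset /= einvK.
case/orP=> eF; rewrite eF ?orbT; split=> //.
- exact: imset_f.
- by rewrite -dicycle_tgt_src ?imset_f.
- by rewrite -tgt_einv -dicycle_tgt_src ?imset_f.
- by rewrite -src_inv imset_f.
Qed.

Lemma card_support_subgraph F : dicycle F -> avoids_inverse F ->
  #|(support_subgraph F).2| = 2 * #|(support_subgraph F).1|.
Proof.
move=> cF aF /=; rewrite cardsU.
have /eqP-> : F :&: @einv G @: F == set0 by rewrite setI_eq0.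
rewrite cards0 subn0.
by rewrite (card_imset _ einv_inj) (card_in_imset (dicycle_src_inj cF)) mul2n addnn.
Qed.

Lemma support_subgraph_circuit F :
  dicycle F -> avoids_inverse F -> support_subgraph F \in circuits G.
Proof.
move=> cF aF; have sH := support_subgraphP cF.
have cH : is_connected (support_subgraph F).
  apply/is_connectedP; split=> [|u v uF vF].
    have [e eF] := set0Pn _ (dicycle_neq0 cF).
    by apply/set0Pn; exists (src e); apply: imset_f.
  apply: connect_sub (dicycle_connected cF uF vF) => {uF vF}u {}v.
  case/existsP=> g /and3P[gF sg tg].
  by apply/connect1/existsP; exists g; rewrite inE gF sg.
rewrite inE; apply/and4P; split=> //; last first.
  by rewrite card_circuit_edges // card_support_subgraph.
apply/forall_inP=> e /setUP[eF|].
  by apply: (dicycle_not_separating sH cH cF aF) => //; apply: subsetUl.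
rewrite mem_einv_imset => eF.
have := dicycle_not_separating sH cH cF aF (subsetUl _ _) eF.
by rewrite /separating /remove_edge einv_pair.
Qed.

(** Pick an edge [e]; as it is not separating, its start can be reached from
anywhere without it. Together with [e], the edges that decrease the distance to
the start of [e] form a traversable set, and the inverse of an edge in this set
is not in the set. *)
Lemma circuit_dicycle H : H \in circuits G ->
  exists2 F, dicycle F & avoids_inverse F /\ F \subset H.2.
Proof.
rewrite inE => /and4P[sH cH nsep bH].
have /is_subgraphP sHP := sH.
have /is_connectedP[H0 _] := cH.
move: bH; rewrite card_circuit_edges // => /eqP bH.
have /card_gt0P[e eH] : 0 < #|H.2| by rewrite bH muln_gt0 card_gt0 H0.
have [_ se te] := sHP e eH.
have /is_connectedP[_ cR] := negbNE (forall_inP nsep e eH).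
have {}cR v : v \in H.1 -> connect (adjacent (remove_edge H e).2) v (src e).
  by move=> vH; apply: cR.
have [d dP] := connect_potential (adjacent (remove_edge H e).2) (src e).
pose D := [set f in (remove_edge H e).2 | d (tgt f) < d (src f)].
have DH : e |: D \subset H.2.
  by apply/subsetP=> f; rewrite !inE => /predU1P[->//|/andP[/andP[]]].
have [|F cF FD] := @minset_exists _ traversable (e |: D).
  apply/traversableP; split; first by apply/set0Pn; exists e; rewrite setU11.
  move=> f fD; have [_ _ tf] := sHP f (subsetP DH _ fD).
  have [->|tfe] := eqVneq (tgt f) (src e); first by exists e; rewrite ?setU11.
  have [w /existsP[g /and3P[gR /eqP gf /eqP gw]] /andP[_ dw]] := dP _ (cR _ tf) tfe.
  exists g => //; rewrite in_setU1 inE gR /=.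
  by rewrite gw gf dw orbT.
exists F => //; split; last exact: subset_trans DH.
have ieD : einv e \notin e |: D by rewrite !inE eqxx orbT /= orbF einv_neq.
apply/avoids_inverseP=> f /(subsetP FD) fD; apply/negP=> /(subsetP FD) ifD.
have fe : f != e by apply: contraNneq (ieD) => fe; rewrite -{1}fe.
have ife : einv f != e by apply: contraNneq (ieD) => ff; rewrite -{1}ff einvK.
move: fD ifD; rewrite !in_setU1 (negbTE fe) (negbTE ife) /= => /setIdP[_ df] /setIdP[_].
by rewrite src_inv tgt_einv ltnNge (ltnW df).
Qed.

(** Deleting an edge outside a cycle, and then one of the cycle, would leave a
connected graph with too few edges. *)
Lemma circuit_support H F : H \in circuits G ->
  dicycle F -> avoids_inverse F -> F \subset H.2 -> support_subgraph F = H.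
Proof.
rewrite inE => /and4P[sH cH nsep bH] cF aF FH.
have /is_subgraphP sHP := sH.
move: bH; rewrite card_circuit_edges // => /eqP bH.
have iFH : F :|: @einv G @: F \subset H.2.
  apply/subsetP=> e; rewrite inE mem_einv_imset => /orP[/(subsetP FH)//|].
  by move=> /(subsetP FH)/sHP[]; rewrite einvK.
have EH : F :|: @einv G @: F = H.2.
  apply/eqP; rewrite eqEsubset iFH; apply/subsetP=> f fH.
  apply/negPn/negP=> nfF.
  have cR : is_connected (remove_edge H f).
    by apply/negPn/(forall_inP nsep f fH).
  have sR := is_subgraph_remove f sH.
  have FR : F \subset (remove_edge H f).2.
    apply/subsetP=> e eF; rewrite inE (subsetP FH) // andbT.
    by apply: contra nfF => /set2P[] ee; rewrite !inE mem_einv_imset -?ee ?ee ?eF ?orbT //;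
      rewrite ee in eF; rewrite eF ?orbT.
  have [e eF] := set0Pn _ (dicycle_neq0 cF).
  have cRR := dicycle_not_separating sR cR cF aF FR eF.
  have := connected_card (is_subgraph_remove e sR) (negbNE cRR).
  rewrite -[2 * _]bH (card_remove_edge sH fH) (card_remove_edge sR (subsetP FR _ eF)).
  by rewrite -addnA leq_add2l.
case: H => V E /= in sH cH nsep bH FH iFH EH sHP *.
rewrite /support_subgraph EH; congr pair; apply/eqP; rewrite eqEcard.
apply/andP; split.
  by apply/subsetP=> _ /imsetP[e /(subsetP FH)/sHP[_ ? _] ->].
by have := card_support_subgraph cF aF; rewrite /= EH bH => /eqP; rewrite eqn_pmul2l // => /eqP->.
Qed.

(** Inside the support of [F], an edge of [F] is followed only by the next edge
of [F] or by its own inverse; a dicycle without the latter kind of turn that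
meets [F] stays in [F]. *)
Lemma support_subgraph_fibre F F' :
  dicycle F -> avoids_inverse F -> dicycle F' -> avoids_inverse F' ->
  support_subgraph F' = support_subgraph F -> F' = F \/ F' = @einv G @: F.
Proof.
move=> cF aF cF' aF' [_ EF].
have half F1 : dicycle F1 -> F' \subset F1 :|: @einv G @: F1 ->
    F' :&: F1 != set0 -> F' = F1.
  move=> cF1 sub ne; apply: (dicycle_sub cF1 cF'); apply/setIidPl.
  apply: (dicycle_closed cF') => //; first exact: subsetIl.
  move=> e f /setIP[eF' eF1] fF' sf; rewrite inE fF' /=.
  have := subsetP sub _ fF'; rewrite inE mem_einv_imset => /orP[//|ifF1].
  have fe : einv f = e.
    by apply: (dicycle_tgt_inj cF1) => //; rewrite tgt_einv.
  by have := avoids_inverseP _ aF' _ eF'; rewrite -fe einvK fF'.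
have [e eF'] := set0Pn _ (dicycle_neq0 cF').
have sub : F' \subset F :|: @einv G @: F by rewrite -EF subsetUl.
have := subsetP sub _ eF'; case/setUP=> eF; [left|right].
  by apply: half => //; apply/set0Pn; exists e; rewrite inE eF' eF.
apply: half; first exact: dicycle_rev.
  rewrite (_ : @einv G @: (@einv G @: F) = F) 1?setUC //.
  by apply/setP=> f; rewrite !mem_einv_imset einvK.
by apply/set0Pn; exists e; rewrite inE eF' eF.
Qed.

Definition dicycles : {set {set oedge G}} := [set F | dicycle F].

(** The fibre of [support_subgraph] over a circuit consists of a dicycle and its
reverse. *)
Lemma card_avoiding_dicycles :
  #|[set F in dicycles | avoids_inverse F]| = 2 * #|circuits G|.
Proof.
rewrite -sum1_card (partition_big support_subgraph (mem (circuits G))) /=; last first.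
  by move=> F; rewrite !inE => /andP[cF aF]; have := support_subgraph_circuit cF aF; rewrite inE.
rewrite mulnC -sum_nat_const; apply: eq_bigr => H HC.
have [F cF [aF FH]] := circuit_dicycle HC.
have FE := circuit_support HC cF aF FH.
have iE : support_subgraph (@einv G @: F) = H by rewrite support_subgraph_rev.
rewrite sum1dep_card (_ : [set _ | _] = [set F; @einv G @: F]); last first.
  apply/setP=> F'; rewrite !inE -andbA; apply/and3P/orP.
    case=> cF' aF' /eqP F'H; rewrite -FE in F'H.
    by have [] := support_subgraph_fibre cF aF cF' aF' F'H => ->; [left|right].
  case=> /eqP->; split=> //; try exact/eqP; [exact: dicycle_rev | exact: avoids_inverse_rev].
rewrite cards2; case: eqP => // FiF.
have [e eF] := set0Pn _ (dicycle_neq0 cF).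
by have := avoids_inverseP _ aF _ eF; rewrite FiF mem_einv_imset einvK eF.
Qed.

Definition loop_edges : {set {set oedge G}} :=
  [set [set e; einv e] | e in [set e : oedge G | src e == tgt e]].

Lemma loop_edge_circuit e : src e = tgt e ->
  ([set src e], [set e; einv e]) \in circuits G.
Proof.
move=> se; have := @support_subgraph_circuit [set e] (dicycle_loop se).
rewrite /support_subgraph !imset_set1; apply.
by apply/avoids_inverseP=> f /set1P->; rewrite inE einv_neq.
Qed.

Lemma single_edge A : (forall e, e \in A -> einv e \in A) ->
  #|edges_of A| = 1 -> exists2 e, e \in A & A = [set e; einv e].
Proof.
move=> invA /eqP/cards1P[S AS].
have AP e : e \in A -> [set e; einv e] = S.
  by move=> eA; apply/set1P; rewrite -AS; apply/imsetP; exists e.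
have /imsetP[e eA _] : S \in edges_of A by rewrite AS set11.
exists e => //; apply/setP=> f; apply/idP/set2P => [fA|[]->//]; last exact: invA.
by apply/set2P; rewrite (AP e eA) -(AP f fA) set21.
Qed.

(** With a single edge, [b1 = 1] leaves room for one vertex only. *)
Lemma loopsP H : reflect
  (exists2 e, src e = tgt e & H = ([set src e], [set e; einv e])) (H \in loops G).
Proof.
apply: (iffP setIdP) => [[HC /eqP E1]|[e se ->]].
  have := HC; rewrite inE => /and4P[sH _ _ bH].
  have /is_subgraphP sHP := sH.
  move: bH; rewrite card_circuit_edges // => /eqP bH.
  have invH e : e \in H.2 -> einv e \in H.2 by case/sHP.
  have [e eH HE] := single_edge invH E1.
  move: bH; rewrite card_edges_of // E1 => /eqP; rewrite eqn_pmul2l // eq_sym.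
  case/cards1P=> v Hv; have [_] := sHP e eH; rewrite Hv => /set1P sv /set1P tv.
  exists e; first by rewrite sv tv.
  by case: H HE Hv {HC E1 sH sHP invH eH} => V E /= -> ->; rewrite sv.
split; first exact: loop_edge_circuit.
apply/cards1P; exists [set e; einv e]; apply/setP=> S.
apply/imsetP/set1P => [[f /set2P[]-> ->//]|->]; first by rewrite /= einv_pair.
by exists e; rewrite ?set21.
Qed.

Lemma card_loops : #|loops G| = #|loop_edges|.
Proof.
rewrite -(@card_in_imset _ _ snd (mem (loops G))).
  apply: eq_card => A; apply/imsetP/imsetP.
    by case=> H /loopsP[e se ->] ->; exists e; rewrite ?inE ?se.
  case=> e; rewrite inE => /eqP se ->; exists ([set src e], [set e; einv e]) => //.
  by apply/loopsP; exists e.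
move=> _ _ /loopsP[e se ->] /loopsP[f sf ->] /= ef; congr pair => //.
have : e \in [set f; einv f] by rewrite -ef set21.
by case/set2P=> -> //; rewrite src_inv sf.
Qed.

(** The dicycles that contain an edge with its inverse are the unoriented edges
that are not loops. *)
Lemma card_returning_dicycles :
  #|[set F in dicycles | ~~ avoids_inverse F]| + #|loops G| = #|edges G|.
Proof.
rewrite card_loops -(cardsID loop_edges (edges G)) addnC; congr (_ + _).
  apply: eq_card=> S; rewrite inE; apply/idP/andP=> [|[]//].
  by move=> SL; split=> //; case/imsetP: SL => e _ ->; apply/imsetP; exists e.
apply: eq_card=> S; rewrite !inE; apply/andP/andP=> -[].
  move=> cS /avoids_inverseP aS; have [e eS ieS] : exists2 e, e \in S & einv e \in S.
    apply: contrapT => nS; apply: aS => e eS; apply/negP=> ieS; apply: nS; by exists e.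
  have SE := dicycle_back_forth cS eS ieS.
  have se : src e != tgt e by rewrite -dicycle_edge -SE.
  split; last by apply/imsetP; exists e.
  apply/imsetP=> -[f]; rewrite inE => /eqP sf SF.
  move: eS se; rewrite SF => /set2P[]->; rewrite ?src_inv ?tgt_einv sf eqxx //.
move=> nL /imsetP[e _ SE]; split.
  rewrite SE dicycle_edge; apply: contra nL => se.
  by apply/imsetP; exists e; rewrite ?inE.
by apply/avoids_inverseP=> /(_ e); rewrite SE set21 set22 => /(_ isT).
Qed.

Lemma card_dicycles :
  #|dicycles| = (2 * #|circuits G| + #|edges G| - #|loops G|)%N.
Proof.
rewrite -card_returning_dicycles addnA addnK -card_avoiding_dicycles.
rewrite -(cardsID [set F | avoids_inverse F] dicycles); congr (_ + _).
  by apply: eq_card=> F; rewrite !inE.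
by apply: eq_card=> F; rewrite !inE andbC.
Qed.

End Circuits.

(** * Indecomposable effective cycles *)

Section Indecomposable.
Local Open Scope ring_scope.
Context {G : graph}.
Implicit Types (e f : oedge G) (F : {set oedge G}) (c d : semigroup G).

Definition edge_indicator F : {ffun oedge G -> int} := [ffun e => (e \in F)%:R].

(** The edges of a dicycle start at the same vertices as they end, once at
each. *)
Lemma edge_indicator_effective F : dicycle F -> edge_indicator F \in effective (G:=G).
Proof.
move=> cF; rewrite !inE; apply/andP; split; last first.
  by apply/forallP=> e; rewrite ffunE ler0n.
rewrite /boundary (eq_bigr (fun e => if e \in F then
    vertex_basis (tgt e) - vertex_basis (src e) else 0)); last first.
  by move=> e _; rewrite ffunE; case: ifP.
rewrite -big_mkcond sumrB subr_eq0.
rewrite -(big_imset _ (dicycle_tgt_inj cF)) -(big_imset _ (dicycle_src_inj cF)) /=.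
by rewrite dicycle_tgt_src.
Qed.

Lemma semigroup_ge0 c e : 0 <= c e.
Proof. by have := semigroup_valP c; rewrite inE => /andP[_ /forallP]. Qed.

Lemma moneE e : (mone : semigroup G) e = 0.
Proof. exact: ffunE. Qed.

Lemma mmulE c d e : (mmul c d : semigroup G) e = c e + d e.
Proof. exact: ffunE. Qed.

(** Balance at the end of an edge in the support provides an edge to go on
with. *)
Lemma support_traversable c : c <> mone -> traversable [set e | c e != 0].
Proof.
move=> c0; apply/traversableP; split.
  apply/negP=> /eqP/setP s0; apply/c0/val_inj/ffunP=> e.
  by rewrite [RHS]ffunE; have := s0 e; rewrite !inE => /negbFE/eqP.
move=> e; rewrite inE => ce.
have [see|see] := eqVneq (tgt e) (src e); first by exists e; rewrite ?inE.
apply/exists2P; apply: contrapT => /forallNP noout.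
have out0 f : src f = tgt e -> c f = 0.
  move=> sf; apply/eqP/negPn/negP => cf; apply: (noout f); split=> //.
  by rewrite inE.
have := semigroup_valP c; rewrite inE => /andP[/eqP/ffunP/(_ (tgt e)) bc _].
move: bc; rewrite sum_ffunE ffunE => bc.
have term f : ((vertex_basis (tgt f) - vertex_basis (src f)) *~ c f) (tgt e)
    = (tgt e == tgt f)%:R * c f.
  rewrite ffunMzE !ffunE -mulrzr intz.
  have [/esym/out0->|_] := eqVneq (tgt e) (src f); first by rewrite !mulr0.
  by rewrite subr0.
move: bc; rewrite (eq_bigr _ (fun f _ => term f)) => /eqP.
rewrite psumr_eq0 => [/allP/(_ e)|f _]; last by rewrite mulr_ge0 ?ler0n ?semigroup_ge0.
by rewrite mem_index_enum eqxx mul1r (negbTE ce) => /(_ isT).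
Qed.

Lemma support_dicycle c : c <> mone ->
  exists2 F, dicycle F & forall e, e \in F -> 1 <= c e.
Proof.
move=> /support_traversable/minset_exists[F cF Fc]; exists F => // e eF.
have := subsetP Fc _ eF; rewrite inE => ce.
by rewrite -gtz0_ge1 lt0r ce semigroup_ge0.
Qed.

(** The support of a nonzero summand contains a dicycle, which by minimality is
[F]; so two nonzero summands add up to at least [2] on [F]. *)
Lemma indecomposable_indicator c F :
  dicycle F -> cycle_val c = edge_indicator F -> indecomposable c.
Proof.
move=> cF cE; split=> [c1|a b ab].
  have [e eF] := set0Pn _ (dicycle_neq0 cF).
  by move/ffunP/(_ e): cE; rewrite c1 moneE ffunE eF.
have le1 d d' : c = mmul d d' -> d <> mone -> forall e, e \in F -> 1 <= d e.
  move=> dd /support_dicycle[F' cF' h].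
  suff <- : F' = F by [].
  apply: (dicycle_sub cF cF'); apply/subsetP=> e /h de.
  have := semigroup_ge0 d' e; apply: contraTT => eF.
  have : c e = 0 by rewrite cE ffunE (negbTE eF).
  rewrite dd mmulE => /eqP; rewrite addrC addr_eq0 => /eqP->.
  by rewrite oppr_ge0 -ltNge (lt_le_trans ltr01).
have [a1|/(le1 _ _ ab) a1] := pselect (a = mone); first by left.
have [b1|b1] := pselect (b = mone); first by right.
have ba : c = mmul b a by rewrite ab; apply: val_inj; rewrite /= addrC.
have {}b1 := le1 _ _ ba b1.
have [e eF] := set0Pn _ (dicycle_neq0 cF).
have := lerD (a1 _ eF) (b1 _ eF).
by rewrite -mmulE -ab cE ffunE eF.
Qed.

(** The indicator of a dicycle in the support of [c] is a nonzero summand of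
[c], hence all of [c]. *)
Lemma indicator_indecomposable c :
  indecomposable c -> exists2 F, dicycle F & cycle_val c = edge_indicator F.
Proof.
case=> c0 irr; have [F cF Fc] := support_dicycle c0; exists F => //.
pose d := Defs.Semigroup (edge_indicator_effective cF).
have d0 : d <> mone.
  by have [] := @indecomposable_indicator d F cF.
have effB : cycle_val c - cycle_val d \in effective (G:=G).
  have := semigroup_valP c; have := semigroup_valP d; rewrite !inE.
  move=> /andP[/eqP bd _] /andP[/eqP bc _]; apply/andP; split.
    rewrite -[X in _ == X](subrr 0) -{1}bc -bd /boundary -sumrB; apply/eqP.
    by apply: eq_bigr=> e _; rewrite !ffunE -mulrzBr.
  apply/forallP=> e; rewrite !ffunE subr_ge0.
  by have [/Fc//|_] := boolP (e \in F); apply: semigroup_ge0.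
case: (irr d (Defs.Semigroup effB)) => [|//|/(congr1 (@cycle_val G))/= e0].
  by apply: val_inj; rewrite /= addrC subrK.
by apply/eqP; rewrite -subr_eq0 e0; apply/eqP.
Qed.

End Indecomposable.

(** * The dimension *)

Theorem proposition4p7 (k : fieldType) (G : graph) :
  has_dim (tangent_space (torus_fixed_point k G))
    (2 * #|circuits G| + #|edges G| - #|loops G|)%N.
Proof.
rewrite -card_dicycles.
have cF (i : 'I_#|dicycles (G := G)|) : dicycle (enum_val i).
  by have := enum_valP i; rewrite inE.
apply: (@tangent_space_dim k G _
  (fun i => Defs.Semigroup (edge_indicator_effective (cF i)))) => [i j|c].
  move=> /(congr1 (@cycle_val G))/ffunP/= ij; apply/enum_val_inj/setP=> e.
  by have := ij e; rewrite !ffunE; do 2!case: (e \in _).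
split=> [/indicator_indecomposable[F dF cE]|[i ->]]; last first.
  exact: (indecomposable_indicator (cF i)).
have FD : F \in dicycles (G := G) by rewrite inE.
exists (enum_rank_in FD F); apply: val_inj; rewrite /= cE.
by rewrite enum_rankK_in.
Qed.
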